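(* Let $p$ be a prime, let $G$ and $H$ be finite-dimensional vector spaces over $\mathbb{F}_p$, and let $0 < \delta \leq 1$. Let $A \subseteq G \times H$ be a transverse set of size at least $\delta |G||H|$. Then $A$ contains a set of the form $\{(x,y) \in U \times V \colon \beta(x,y) = 0\}$, where $U \leq G$ and $V \leq H$ are subspaces and $\beta \colon G \times H \to \mathbb{F}_p^r$ is a bilinear map (for some non-negative integer $r$), obeying the bounds $\operatorname{codim}_G U = O\big((\log_p \delta^{-1})^3\big)$, $\operatorname{codim}_H V = O\big((\log_p \delta^{-1})^2\big)$ and $r = O(\log_p \delta^{-1})$.
   Context: A subset $A \subseteq G \times H$ is called transverse if for every $x \in G$ the column $\{y \in H \colon (x,y) \in A\}$ is a non-empty subspace of $H$, and for every $y \in H$ the row $\{x \in G \colon (x,y) \in A\}$ is a non-empty subspace of $G$. The notation $U \leq G$ means that $U$ is a subspace of $G$, and $\operatorname{codim}_G U = \dim G - \dim U$. The notation $O(X)$ denotes a quantity bounded in absolute value by $C|X|$, where $C$ is an absolute constant (independent of $p, G, H, \delta, A$). *)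

(* Defs.v *)
From HB Require Import structures.
From mathcomp Require Import all_boot all_order all_algebra all_field.
From mathcomp Require Import reals exp.
Set Implicit Arguments.
Unset Strict Implicit.
Unset Printing Implicit Defensive.
Import Order.TTheory GRing.Theory Num.Theory.
Local Open Scope ring_scope.

(* [finvect_type V] is [V] itself, carrying the [finType] structure that a
   finite-dimensional space over a finite field has; it gives access to {set _}
   and #|_|.  Elements of {vspace V} are the linear subspaces of V, and always
   contain 0. *)
Section Transverse.
Variables (F : finFieldType) (G H : vectType F).
Implicit Types (A : {set finvect_type G * finvect_type H}).

Definition column_set A (x : finvect_type G) : {set finvect_type H} :=
  [set y | (x, y) \in A].

Definition row_set A (y : finvect_type H) : {set finvect_type G} :=
  [set x | (x, y) \in A].

Definition is_subspace (V : vectType F) (S : {set finvect_type V}) : Prop :=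
  exists W : {vspace V}, S = [set v : finvect_type V | (v : V) \in W].

Definition transverse A : Prop :=
  (forall x, is_subspace (column_set A x)) /\ (forall y, is_subspace (row_set A y)).

(* A bilinear map G x H -> F^r in curried form; for r = 0 the target is the
   zero space. *)
Definition bilinear_variety (U : {vspace G}) (V : {vspace H}) (r : nat)
    (beta : {bilinear G -> H -> 'rV[F]_r}) : {set finvect_type G * finvect_type H} :=
  [set xy : finvect_type G * finvect_type H |
    [&& (xy.1 : G) \in U, (xy.2 : H) \in V & beta xy.1 xy.2 == 0]].

End Transverse.

(* \dim U <= \dim {:V} always, so the natural subtraction is exact. *)
Definition codimv (F : fieldType) (V : vectType F) (U : {vspace V}) : nat :=
  (\dim {:V} - \dim U)%N.

Definition logb (R : realType) (b : nat) (x : R) : R := ln x / ln b%:R.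

(* Main.v *)
(** Write [col x] and [row y] for the columns and rows of [A] and let [p^-K] be
    the density of [A]. Transversality says exactly that [col x :&: col x'] lies
    in [col (x + x')].

    For an average [y], a random element of [row y] has a column of codimension
    at most [K + 1] with probability above 1/2, so that every element of [row y]
    is a sum of two such elements: on a subspace of codimension O(K), all columns
    have codimension O(K). Applying this on both sides bounds all columns and
    all rows on some [U1] and [V1].

    Let [r] be the maximal codimension of a column over [U1]. Cutting [V1] down
    by a column of maximal codimension cannot increase [r], so after O(K) cuts
    one gets [V] and [x1, x2] in [U1] such that [col x1] has maximal codimension
    [r] in [V], and [col x2] still has codimension [r] in [V :&: col x1]. Choose
    complements [Y1], [Y2] of [V :&: col x1 :&: col x2] in [V :&: col x2] and in
    [V :&: col x1], and let [U] be the set of all [x] in [U1] whose column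
    contains [Y1 + Y2]. For [x] in [U], by maximality of [r], [V] is the direct
    sum of [Y1] and [V :&: col (x1 + x)]; let [P1 x] be the projection onto [Y1].
    The form is [P1 x v - P1 0 v]: if it vanishes then [v - P1 x v] lies in
    [col (x1 + x) :&: col x1], hence in [col x], and so does [P1 x v]. It is
    additive in [x] because, with [P2] the analogous projection onto [Y2],
    [v - P1 x v - P2 x' v] lies in [col (x1 + x2 + (x + x'))], which only depends
    on [x + x']. *)

Require Import Defs.
From HB Require Import structures.
From mathcomp Require Import all_boot all_order all_algebra all_field.
From mathcomp Require Import reals exp.
From mathcomp Require Import zify lra.
Set Implicit Arguments.
Unset Strict Implicit.
Unset Printing Implicit Defensive.
Import Order.TTheory GRing.Theory Num.Theory.
Local Open Scope ring_scope.

(** * Counting over finite vector spaces *)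

Lemma card_vset (F : finFieldType) (V : vectType F) (U : {vspace V}) :
  #|[set v : finvect_type V | (v : V) \in U]| = (#|F| ^ \dim U)%N.
Proof.
rewrite cardsE; case: V U => T cT U.
etransitivity; last exact: (@card_vspace F (finvect_type (Vector.Pack cT)) cT U).
by apply: eq_card.
Qed.

Lemma double_count (I J : finType) (P : pred I) (Q : pred J) (e : I -> J -> bool) :
  (\sum_(i | P i) #|[set j | Q j & e i j]| = \sum_(j | Q j) #|[set i | P i & e i j]|)%N.
Proof.
have cardE (T : finType) (B : pred T) (f : T -> bool) :
    #|[set t | B t & f t]| = (\sum_(t | B t) f t)%N.
  rewrite -sum1_card (eq_bigl (fun t => B t && f t)) => [|t]; last by rewrite inE.
  by rewrite big_mkcondr; apply: eq_bigr => t _; case: (f t).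
under eq_bigr do rewrite cardE.
by rewrite exchange_big; under [in RHS]eq_bigr do rewrite cardE.
Qed.

(** For [exists_biadditive]: primed letters stand for values of [P2], the others for values of [P1].
    The [P2] terms cancel and leave the additivity defect of [P1 x - P1 0]. *)
Lemma swap_difference (V : zmodType) (ab a b z b' z' : V) :
  z + b' - (b + z') - (a + b' - (ab + z')) = ab - z - (a - z + (b - z)).
Proof.
have -> : a + b' - (ab + z') = (b' - z') + (a - ab) by rewrite opprD addrACA addrC.
have -> : z + b' - (b + z') = (z - b) + (b' - z') by rewrite opprD addrACA.
rewrite [- (b' - z' + _)]opprD addrA addrK opprB.
rewrite [- (a - z + _)]opprD !opprB [ab - z + _]addrA [ab - z + _]addrA subrK.
by rewrite addrC.
Qed.

(** * Columns and rows of bounded codimension *)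

Section Transverse.
Variables (F : finFieldType) (G H : vectType F).
Variables (col : G -> {vspace H}) (row : H -> {vspace G}).
Hypothesis mem_row : forall x y, (x \in row y) = (y \in col x).

Lemma col_capD x x' : (col x :&: col x' <= col (x + x'))%VS.
Proof.
by apply/subvP=> y /memv_capP[]; rewrite -!mem_row => ? ?; apply: memvD.
Qed.

Lemma mem_colD x x' v : v \in col x -> v \in col x' -> v \in col (x + x').
Proof. by rewrite -!mem_row; apply: memvD. Qed.

Lemma col0 : col 0 = fullv.
Proof. by apply/vspaceP=> y; rewrite memvf -mem_row mem0v. Qed.

Lemma colN x : col (- x) = col x.
Proof. by apply/vspaceP=> y; rewrite -!mem_row memvN. Qed.

Lemma col_capB x x' : (col x :&: col x' <= col (x - x'))%VS.
Proof. by rewrite -(colN x') col_capD. Qed.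

Lemma dim_cap_cap (V A B : {vspace H}) :
  (\dim (V :&: A) + \dim (V :&: B) <= \dim V + \dim (V :&: (A :&: B)))%N.
Proof.
rewrite -dimv_sum_cap leq_add //; first by rewrite dimvS // subv_add !capvSl.
rewrite dimvS //; apply/subvP=> y; rewrite !memv_cap.
by case/andP=> /andP[-> ->] /andP[_ ->].
Qed.

(** Both sides count the pairs in [U] x [V] with [y \in col x]. *)
Lemma sum_rows (U : {vspace G}) (V : {vspace H}) :
  (\sum_(x : finvect_type G | (x : G) \in U) #|F| ^ \dim (V :&: col x) =
   \sum_(y : finvect_type H | (y : H) \in V) #|F| ^ \dim (U :&: row y))%N.
Proof.
have := double_count (fun x : finvect_type G => (x : G) \in U)
  (fun y : finvect_type H => (y : H) \in V) (fun x y => (x : G) \in row y).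
congr (_ = _); apply: eq_bigr => z _; rewrite -card_vset; apply: eq_card => t.
  by rewrite !inE memv_cap mem_row.
by rewrite !inE memv_cap.
Qed.

(** Bad columns, of codimension at least [K + 2], contribute at most a fraction [q ^ -(K + 2)] of
    all pairs. Averaging over [y] gives a large row with less than half of its elements bad, so each
    of its elements is a sum of two good ones. *)
Lemma exists_row_bounded_cols (K : nat) (U : {vspace G}) (V : {vspace H}) :
  (#|F| ^ (\dim U + \dim V) <=
     #|F| ^ K * \sum_(x : finvect_type G | (x : G) \in U) #|F| ^ \dim (V :&: col x))%N ->
  exists y, [/\ y \in V, (\dim U <= \dim (U :&: row y) + K.+1)%N &
    forall x, x \in (U :&: row y)%VS -> (\dim V <= \dim (V :&: col x) + 2 * K.+1)%N].
Proof.
set q := #|F|; have q1 : (1 < q)%N := finNzRing_gt1 F.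
have q0 : (0 < q)%N by rewrite ltnW.
pose bad (x : finvect_type G) := (\dim (V :&: col x) + K.+1 < \dim V)%N.
pose R (y : finvect_type H) := [set x : finvect_type G | (x : G) \in U & (x : G) \in row y].
pose Rb (y : finvect_type H) :=
  [set x : finvect_type G | ((x : G) \in U) && bad x & (x : G) \in row y].
have cardR y : #|R y| = (q ^ \dim (U :&: row y))%N.
  by rewrite -card_vset; apply: eq_card => x; rewrite !inE memv_cap.
have cardC x : #|[set y : finvect_type H | (y : H) \in V & (x : G) \in row y]|
     = (q ^ \dim (V :&: col x))%N.
  by rewrite -card_vset; apply: eq_card => y; rewrite !inE memv_cap mem_row.
have sumR : (\sum_(x : finvect_type G | (x : G) \in U) q ^ \dim (V :&: col x) =
    \sum_(y : finvect_type H | (y : H) \in V) #|R y|)%N.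
  by rewrite sum_rows; apply: eq_bigr => y _; rewrite cardR.
have sumRb : (q ^ K.+2 * \sum_(y : finvect_type H | (y : H) \in V) #|Rb y| <=
    q ^ (\dim U + \dim V))%N.
  rewrite -double_count big_distrr /= (leq_trans (_ : _ <=
     \sum_(x : finvect_type G | ((x : G) \in U) && bad x) q ^ \dim V)%N) //.
    apply: leq_sum => x /andP[_ badx]; rewrite cardC -expnD leq_pexp2l //.
    by move: badx; rewrite /bad; lia.
  rewrite sum_nat_const expnD leq_mul2r -(card_vset U) subset_leq_card ?orbT //.
  by apply/subsetP=> x; rewrite !inE unfold_in => /andP[].
rewrite sumR => dense.
(* The first term on the left makes the row large; the second keeps its bad elements below one
   half. *)
have [y Vy good] : exists2 y : finvect_type H, (y : H) \in V &
    (q ^ \dim U + 2 * (q ^ K.+2 * #|Rb y|) < q ^ K.+2 * #|R y|)%N.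
  case: (boolP [exists y : finvect_type H, ((y : H) \in V) &&
     (q ^ \dim U + 2 * (q ^ K.+2 * #|Rb y|) < q ^ K.+2 * #|R y|)%N]).
    by move=> /existsP[y /andP[]]; exists y.
  rewrite negb_exists => /forallP none; exfalso.
  have : (q ^ K.+2 * \sum_(y : finvect_type H | (y : H) \in V) #|R y| <=
     q ^ (\dim U + \dim V) + 2 * (q ^ K.+2 * \sum_(y : finvect_type H | (y : H) \in V) #|Rb y|))%N.
    have -> : (q ^ (\dim U + \dim V) = \sum_(y : finvect_type H | (y : H) \in V) q ^ \dim U)%N.
      rewrite sum_nat_const expnD mulnC; congr (_ * _)%N.
      by rewrite -(card_vset V) cardsE.
    rewrite !big_distrr /= -big_split /=; apply: leq_sum => y Vy.
    by have := none y; rewrite Vy /= -leqNgt.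
  (* If no [y] works, the left sides total at most [1 + 2 = 3] times [q ^ (\dim U + \dim V)], while
     density makes the right sides total at least [q ^ 2 >= 4] times that. *)
  have q4 : (4 <= q ^ 2)%N by rewrite -mulnn (leq_mul q1 q1).
  have pos : (0 < q ^ (\dim U + \dim V))%N by rewrite expn_gt0 q0.
  have := leq_mul q4 (leqnn (q ^ (\dim U + \dim V))).
  have -> : (q ^ K.+2 = q ^ 2 * q ^ K)%N by rewrite -expnD.
  move: dense; rewrite -(leq_pmul2l (_ : 0 < q ^ 2)%N) ?expn_gt0 ?q0 // mulnA.
  move: sumRb pos; rewrite -[K.+2]add2n expnD; set N := (q ^ (\dim U + _))%N.
  move: N (_ * _ * \sum_(y | _) #|R y|)%N (_ * _ * \sum_(y | _) #|Rb y|)%N => N SR SB.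
  move: (q ^ 2 * N)%N; lia.
rewrite cardR in good; exists y; split=> //.
  rewrite leqNgt; apply/negP=> small.
  have : (q ^ (K.+2 + \dim (U :&: row y)) <= q ^ \dim U)%N.
    by rewrite leq_pexp2l // addnC addnS.
  by rewrite expnD leqNgt (leq_ltn_trans (leq_addr _ _) good).
move=> x Wx; set W := (U :&: row y)%VS in good Wx *.
have lt_bad : (2 * #|Rb y| < #|R y|)%N.
  have := expn_gt0 q K.+2; rewrite q0 /= => p0.
  rewrite -(ltn_pmul2l p0) cardR mulnCA.
  exact: leq_ltn_trans (leq_addl _ _) good.
(* [Rb y] and its reflection under [u |-> x - u] together do not cover the row, so some [u] has both
   [u] and [x - u] good. *)
pose f (u : finvect_type G) : finvect_type G := (x : G) - (u : G).
have [u Wu [gu gv]] : exists2 u : finvect_type G, (u : G) \in W &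
    ~~ bad u /\ ~~ bad (x - u : G).
  have [u] : exists u, u \in R y :\: (Rb y :|: f @: Rb y).
    apply/set0Pn; rewrite -card_gt0 cardsD subn_gt0.
    rewrite (leq_ltn_trans (subset_leq_card (subsetIr _ _))) //.
    rewrite (leq_ltn_trans (leq_card_setU _ _)) //.
    by rewrite (leq_ltn_trans _ lt_bad) // mul2n -addnn leq_add2l leq_imset_card.
  rewrite inE => /andP[nb Ru]; have Wu : (u : G) \in W.
    by move: Ru; rewrite inE memv_cap.
  exists u => //; move: nb; rewrite in_setU negb_or => /andP[nb1 nb2]; split.
    by apply: contra nb1 => b; move: Wu; rewrite memv_cap !inE b andbT.
  apply: contra nb2 => b; apply/imsetP; exists (f u); last by rewrite /f subKr.
  by move: (memvB Wx Wu); rewrite memv_cap !inE b andbT.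
have := dim_cap_cap V (col u) (col (x - u)).
have : (\dim (V :&: (col u :&: col (x - u))) <= \dim (V :&: col x))%N.
  rewrite dimvS // capvS //; apply: subv_trans (col_capD _ _) _.
  by rewrite addrC subrK.
by move: gu gv; rewrite /bad -!leqNgt; lia.
Qed.

(** Induction on [n]. If codimension [n + 1] is not attained in [V], or no longer attained in
    [V :&: col x1], the bound drops to [n]; the cut costs at most [n + 1] dimensions, and
    [n * n + (n + 1) <= (n + 1) ^ 2]. Otherwise [x1] and [x2] both attain it and [r = n + 1]. *)
Lemma exists_stable_pair (n : nat) (U : {vspace G}) (V : {vspace H}) :
  (forall x, x \in U -> (\dim V <= \dim (V :&: col x) + n)%N) ->
  exists (V' : {vspace H}) (r : nat) (x1 x2 : G),
  [/\ (V' <= V)%VS, (\dim V <= \dim V' + n * n)%N, [/\ (r <= n)%N, x1 \in U & x2 \in U],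
     forall x, x \in U -> (\dim V' <= \dim (V' :&: col x) + r)%N &
     (\dim V' = \dim (V' :&: (col x1 :&: col x2)) + 2 * r)%N].
Proof.
elim: n V => [|n IHn] V bound.
  exists V, 0%N, 0, 0; rewrite !mem0v; split=> //; first by rewrite addn0.
  by rewrite col0 !capvf addn0.
have [/existsP[x1 /andP[Ux1 e1]]|none] := boolP [exists x : finvect_type G,
   ((x : G) \in U) && (\dim (V :&: col x) + n < \dim V)%N]; last first.
  have [x Ux|V' [r [x1 [x2 [sV dV [rn Uy1 Uy2] bV eV]]]]] := IHn V.
    move: none; rewrite negb_exists => /forallP/(_ x); by rewrite Ux /= -leqNgt.
  by exists V', r, x1, x2; split=> //; [nia | split=> //; lia].
have [/existsP[x2 /andP[Ux2 e2]]|none] := boolP [exists x : finvect_type G,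
   ((x : G) \in U) && (\dim (V :&: col x1 :&: col x) + n < \dim (V :&: col x1))%N].
  exists V, n.+1, x1, x2; split=> //; first by rewrite leq_addr.
  have := bound _ Ux1; have := bound _ Ux2; have := dim_cap_cap V (col x1) (col x2).
  by rewrite capvA; lia.
have [x Ux|V' [r [y1 [y2 [sV dV [rn Uy1 Uy2] bV eV]]]]] := IHn (V :&: col x1)%VS.
  move: none; rewrite negb_exists => /forallP/(_ x); by rewrite Ux /= -leqNgt.
exists V', r, y1, y2; split=> //; first by apply: subv_trans sV (capvSl _ _).
- by have := bound _ Ux1; nia.
- by split=> //; lia.
Qed.

(** * Construction of the biadditive map *)

Lemma dim_cap_rows (U : {vspace G}) (c : nat) (s : seq H) :
  (forall y, y \in s -> (\dim U <= \dim (U :&: row y) + c)%N) ->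
  exists U' : {vspace G}, [/\ (U' <= U)%VS, (\dim U <= \dim U' + size s * c)%N &
    forall x, x \in U' -> (<<s>> <= col x)%VS].
Proof.
elim: s => [|y s IHs] bound.
  by exists U; split=> // [|x _]; rewrite ?addn0 // span_nil sub0v.
have [z sz|U' [sU dU cU]] := IHs; first by apply: bound; rewrite inE sz orbT.
exists (U' :&: row y)%VS; split.
- exact: subv_trans (capvSl _ _) sU.
- have := bound y (mem_head _ _).
  have := dimv_sum_cap U' (U :&: row y).
  have : (\dim (U' + (U :&: row y)) <= \dim U)%N by rewrite dimvS // subv_add sU capvSl.
  by rewrite capvA (capv_idPl sU) /=; lia.
- move=> x; rewrite memv_cap => /andP[U'x xy].
  by rewrite span_cons subv_add cU // andbT -memvE -mem_row.
Qed.

Lemma daddv_pi_sub (W Y : {vspace H}) v :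
  (Y :&: W = 0)%VS -> v \in (Y + W)%VS -> v - daddv_pi Y W v \in W.
Proof.
move=> dYW /(daddv_pi_add dYW) eq_v.
by rewrite -[X in X - _]eq_v addrC addKr memv_pi.
Qed.

(** An element of [Y] in [col (z + x)] also lies in [col x], hence in [col z], so it is 0. Counting
    dimensions then gives the sum. *)
Lemma shifted_complement (V Y : {vspace H}) x z :
    (Y <= V)%VS -> (Y <= col x)%VS -> (Y :&: col z = 0)%VS ->
    (\dim V <= \dim (V :&: col (z + x)) + \dim Y)%N ->
  (Y :&: (V :&: col (z + x)) = 0)%VS /\ (V <= Y + (V :&: col (z + x)))%VS.
Proof.
move=> YV Yx Yz dimV.
have dis : (Y :&: (V :&: col (z + x)) = 0)%VS.
  apply/eqP; rewrite -subv0 -Yz subv_cap capvSl.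
  apply/subvP=> v /memv_capP[Yv /memv_capP[_ zxv]].
  apply: (subvP (_ : col (z + x) :&: col x <= _)%VS v); last first.
    by rewrite memv_cap zxv (subvP Yx).
  by apply: subv_trans (col_capB _ _) _; rewrite addrK.
split=> //; have sV : (Y + (V :&: col (z + x)) <= V)%VS by rewrite subv_add YV capvSl.
by rewrite -(dimv_leqif_sup sV) eqn_leq dimvS // dimv_disjoint_sum // addnC.
Qed.

Lemma exists_biadditive (U : {vspace G}) (V : {vspace H}) (r c : nat) x1 x2 :
    x1 \in U -> x2 \in U ->
    (forall x, x \in U -> (\dim V <= \dim (V :&: col x) + r)%N) ->
    (\dim V = \dim (V :&: (col x1 :&: col x2)) + 2 * r)%N ->
    (forall y, y \in V -> (\dim U <= \dim (U :&: row y) + c)%N) ->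
  exists (U' : {vspace G}) (Y : {vspace H}) (P : G -> 'End(H)),
  [/\ (\dim U <= \dim U' + 2 * r * c)%N, (\dim Y = r)%N,
     forall x v, P x v \in Y,
     forall x x' v, x \in U' -> x' \in U' -> v \in V -> P (x + x') v = P x v + P x' v &
     forall x v, x \in U' -> v \in V -> P x v = 0 -> v \in col x].
Proof.
move=> Ux1 Ux2 bound dimV rows.
pose V0 := (V :&: (col x1 :&: col x2))%VS.
pose Y1 := ((V :&: col x2) :\: V0)%VS; pose Y2 := ((V :&: col x1) :\: V0)%VS.
have Y1V : (Y1 <= V)%VS by rewrite (subv_trans (diffvSl _ _)) ?capvSl.
have Y2V : (Y2 <= V)%VS by rewrite (subv_trans (diffvSl _ _)) ?capvSl.
have Y1c : (Y1 <= col x2)%VS by rewrite (subv_trans (diffvSl _ _)) ?capvSr.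
have Y2c : (Y2 <= col x1)%VS by rewrite (subv_trans (diffvSl _ _)) ?capvSr.
have Y1x1 : (Y1 :&: col x1 = 0)%VS.
  apply/eqP; rewrite -subv0 -(capv_diff (V :&: col x2) V0) -/Y1 subv_cap capvSl /V0.
  by rewrite !subv_cap capvSr (subv_trans (capvSl _ _) Y1V) (subv_trans (capvSl _ _) Y1c).
have Y2x2 : (Y2 :&: col x2 = 0)%VS.
  apply/eqP; rewrite -subv0 -(capv_diff (V :&: col x1) V0) -/Y2 subv_cap capvSl /V0.
  by rewrite !subv_cap capvSr (subv_trans (capvSl _ _) Y2V) (subv_trans (capvSl _ _) Y2c).
have [dimY1 dimY2] : (\dim Y1 = r)%N /\ (\dim Y2 = r)%N.
  have := dimv_cap_compl (V :&: col x2) V0; have := dimv_cap_compl (V :&: col x1) V0.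
  have /capv_idPr -> : (V0 <= V :&: col x1)%VS by rewrite capvS ?capvSl.
  have /capv_idPr -> : (V0 <= V :&: col x2)%VS by rewrite capvS ?capvSr.
  have := bound _ Ux1; have := bound _ Ux2; have := dim_cap_cap V (col x1) (col x2).
  by rewrite -/Y1 -/Y2 -/V0 dimV -/V0; lia.
(* [U'] is cut out by the rows of [2 * r] basis vectors, at a cost of at most [c] dimensions
   each. *)
have [y|U' [sU dimU YU']] := @dim_cap_rows U c (vbasis Y1 ++ vbasis Y2).
  rewrite mem_cat => /orP[] /vbasis_mem yY; apply: rows.
    exact: subvP Y1V _ yY.
  exact: subvP Y2V _ yY.
rewrite size_cat !size_tuple dimY1 dimY2 in dimU.
have {}YU' x : x \in U' -> (Y1 <= col x)%VS /\ (Y2 <= col x)%VS.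
  by move/YU'; rewrite span_cat !(span_basis (vbasisP _)) subv_add => /andP[].
pose P1 x := daddv_pi Y1 (V :&: col (x1 + x)).
pose P2 x := daddv_pi Y2 (V :&: col (x2 + x)).
have P1P x v : x \in U' -> v \in V -> v - P1 x v \in col (x1 + x).
  move=> U'x Vv; have [Y1x _] := YU' _ U'x.
  have [|dis sum] := @shifted_complement V Y1 x x1 Y1V Y1x Y1x1.
    by rewrite dimY1 bound // memvD // (subvP sU).
  by have /memv_capP[] := daddv_pi_sub dis (subvP sum _ Vv).
have P2P x v : x \in U' -> v \in V -> v - P2 x v \in col (x2 + x).
  move=> U'x Vv; have [_ Y2x] := YU' _ U'x.
  have [|dis sum] := @shifted_complement V Y2 x x2 Y2V Y2x Y2x2.
    by rewrite dimY2 bound // memvD // (subvP sU).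
  by have /memv_capP[] := daddv_pi_sub dis (subvP sum _ Vv).
have Y1P x v : P1 x v \in Y1 by exact: memv_pi.
have Y2P x v : P2 x v \in Y2 by exact: memv_pi.
exists U', Y1, (fun x => P1 x - P1 0); split=> //.
- by rewrite (leq_trans dimU) // leq_add2l mul2n addnn.
- by move=> x v; rewrite add_lfunE opp_lfunE memvB.
- move=> a b v Ua Ub Vv; have U0 := mem0v U'.
  (* [P2 x' v] lies in [col x1] and in [col x], so subtracting it from [v - P1 x v] stays in
     [col (x1 + x)]. Symmetrically the vector lies in [col (x2 + x')]. *)
  have mixed x x' : x \in U' -> x' \in U' ->
      v - (P1 x v + P2 x' v) \in col (x1 + x + (x2 + x')).
    move=> Ux Ux'; have [[Y1x Y2x] [Y1x' Y2x']] := (YU' _ Ux, YU' _ Ux').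
    rewrite opprD addrA; apply: mem_colD.
      apply: memvB; [exact: P1P | apply: mem_colD].
        exact: subvP Y2c _ (Y2P _ _).
      exact: subvP Y2x _ (Y2P _ _).
    rewrite addrAC; apply: memvB; [exact: P2P | apply: mem_colD].
      exact: subvP Y1c _ (Y1P _ _).
    exact: subvP Y1x' _ (Y1P _ _).
  (* The two decompositions of [v] differ by an element of [Y1 + Y2], which is
     contained in [col (x + x')], so the shift by [x + x'] can be removed. *)
  have swap x x' y y' : x \in U' -> x' \in U' -> y \in U' -> y' \in U' ->
      x + x' = y + y' -> P1 x v + P2 x' v - (P1 y v + P2 y' v) \in col (x1 + x2).
    move=> Ux Ux' Uy Uy' eq_s.
    have [Y1s Y2s] := YU' _ (memvD Ux Ux').
    have -> : x1 + x2 = x1 + x2 + (x + x') + - (x + x') by rewrite addrK.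
    apply: mem_colD; last first.
      rewrite colN; apply: memvB; apply: memvD.
      - exact: subvP Y1s _ (Y1P _ _).
      - exact: subvP Y2s _ (Y2P _ _).
      - exact: subvP Y1s _ (Y1P _ _).
      - exact: subvP Y2s _ (Y2P _ _).
    have diffE (s t : H) : v - s - (v - t) = t - s by rewrite opprB addrC addrA subrK.
    have := mixed _ _ Ux Ux'; have := mixed _ _ Uy Uy'.
    rewrite (addrACA x1 x) (addrACA x1 y) eq_s => /memvB mem /mem.
    by rewrite diffE.
  (* Subtracting the vector of [E1] from that of [E2] gives the additivity defect. It lies in [Y1],
     hence in [col x2], and in [col (x1 + x2)], so in [Y1 :&: col x1 = 0]. *)
  have E1 := swap a b (a + b) 0 Ua Ub (memvD Ua Ub) U0 (esym (addr0 _)).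
  have E2 := swap 0 b b 0 U0 Ub Ub U0 (addrC _ _).
  apply/eqP; rewrite -subr_eq0 -memv0 -Y1x1 !(add_lfunE, opp_lfunE) memv_cap.
  have Yw : P1 (a + b) v - P1 0 v - (P1 a v - P1 0 v + (P1 b v - P1 0 v)) \in Y1.
    by rewrite !(memvB, memvD).
  have -> : x1 = x1 + x2 - x2 by rewrite addrK.
  rewrite Yw (subvP (col_capB _ _)) // memv_cap (subvP Y1c _ Yw) andbT.
  by have := memvB E2 E1; rewrite swap_difference.
- move=> x v Ux Vv; rewrite add_lfunE opp_lfunE => /eqP; rewrite subr_eq0 => /eqP eqP1.
  have [Y1x _] := YU' _ Ux.
  rewrite -[X in X \in _](subrK (P1 x v)).
  apply: memvD; last exact: subvP Y1x _ (Y1P _ _).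
  have := P1P _ _ Ux Vv; have := P1P _ _ (mem0v _) Vv; rewrite -eqP1.
  set w := v - _; move=> w1 w2; have -> : x = x1 + x - (x1 + 0).
    by rewrite addr0 addrC addKr.
  by apply: mem_colD; rewrite ?colN.
Qed.

End Transverse.

(** In each codimension bound the first summand is the cost of passing to [U1] or [V1]. The second
    comes from the [2 * r] rows, with [r <= 2 * K.+1], or from the cuts of [exists_stable_pair]. *)
Lemma exists_biadditive_of_dense (F : finFieldType) (G H : vectType F)
    (col : G -> {vspace H}) (row : H -> {vspace G}) (K : nat) :
    (forall x y, (x \in row y) = (y \in col x)) ->
    (#|F| ^ (\dim {:G} + \dim {:H}) <=
       #|F| ^ K * \sum_(x : finvect_type G) #|F| ^ \dim (col x))%N ->
  exists (U : {vspace G}) (V : {vspace H}) (Y : {vspace H}) (P : G -> 'End(H)),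
  [/\ [/\ (\dim {:G} <= \dim U + (K.+1 + 2 * (2 * K.+1) * (2 * (2 * K.+1).+1)))%N,
         (\dim {:H} <= \dim V + ((2 * K.+1).+1 + 2 * K.+1 * (2 * K.+1)))%N &
         (\dim Y <= 2 * K.+1)%N],
     forall x v, P x v \in Y,
     forall x x' v, x \in U -> x' \in U -> v \in V -> P (x + x') v = P x v + P x' v &
     forall x v, x \in U -> v \in V -> P x v = 0 -> v \in col x].
Proof.
move=> mem_row dense.
have mem_col y x : (y \in col x) = (x \in row y) by rewrite mem_row.
have [|y0 [_ dimU1 cols]] := @exists_row_bounded_cols _ _ _ col row mem_row K fullv fullv.
  apply: leq_trans dense _; rewrite leq_mul2l; apply/orP; right.
  by apply/eq_leq/eq_big => [x|x _]; rewrite ?memvf // capfv.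
move: dimU1 cols; set U1 := (fullv :&: row y0)%VS => dimU1 cols.
(* The roles of [G] and [H] are exchanged: all columns over [U1] have codimension at most
   [2 * K.+1], which is the new density exponent. *)
have [|x0 [Ux0 dimV1 rows]] :=
    @exists_row_bounded_cols _ _ _ row col mem_col (2 * K.+1) fullv U1.
  rewrite (sum_rows mem_col) (_ : #|F| ^ _ =
      \sum_(x : finvect_type G | (x : G) \in U1) #|F| ^ \dim {:H})%N.
    rewrite big_distrr /=; apply: leq_sum => x Ux.
    by rewrite -expnD leq_pexp2l ?finNzRing_gt1 ?(ltnW (finNzRing_gt1 F)) // addnC cols.
  by rewrite sum_nat_const expnD mulnC -card_vset cardsE.
move: dimV1 rows; set V1 := (fullv :&: col x0)%VS => dimV1 rows.
have [x Ux|V [r [x1 [x2 [sV dimV [ler Ux1 Ux2] bound eqV]]]]] :=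
    @exists_stable_pair _ _ _ col row mem_row (2 * K.+1) U1 V1.
  have := dim_cap_cap fullv V1 (col x); have := cols _ Ux; rewrite !capfv.
  by lia.
have [y Vy|U [Y [P [dimU dimY PY addP kerP]]]] :=
    exists_biadditive mem_row Ux1 Ux2 bound eqV (c := 2 * (2 * K.+1).+1).
  by apply: rows; apply: subvP sV _ Vy.
exists U, V, Y, P; split=> //; split; rewrite ?dimY //.
  have : (2 * r * (2 * (2 * K.+1).+1) <= 2 * (2 * K.+1) * (2 * (2 * K.+1).+1))%N.
    by rewrite leq_mul2r leq_mul2l ler !orbT.
  lia.
lia.
Qed.

(** Every scalar of ['F_p] is a natural multiple of 1, so additivity in the first variable implies
    linearity. *)
Lemma biadditive_Fp_bilinear (p : nat) (G H : lmodType 'F_p) (W : lmodType 'F_p)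
    (f : G -> H -> W) :
    prime p -> (forall y, {morph f^~ y : x x' / x + x'}) -> (forall x, linear (f x)) ->
  exists beta : {bilinear G -> H -> W}, forall x y, beta x y = f x y.
Proof.
move=> p_pr fD flin.
have f0 y : f 0 y = 0 by apply: (addIr (f 0 y)); rewrite -fD !add0r.
have fMn n x y : f (x *+ n) y = f x y *+ n.
  by elim: n => [|n IHn]; rewrite ?mulr0n // !mulrS fD IHn.
have fbil : bilinear_for *:%R *:%R f.
  split=> [y a x x'|x a y y'] /=; last exact: flin.
  by rewrite fD -[a]natr_Zp !scaler_nat fMn.
pose beta : {bilinear G -> H -> W} :=
  HB.pack f (bilinear_isBilinear.Build _ _ _ _ _ _ f fbil).
by exists beta.
Qed.

(** For [y] outside the proper subspace [col x0] the row of [y] is proper as well, so the density is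
    at most [1/q + (1 - 1/q)/q = (2q - 1)/q^2]. This keeps the density away from 1. *)
Lemma nonfull_density_gap (F : finFieldType) (G H : vectType F)
    (col : G -> {vspace H}) (row : H -> {vspace G}) x0 y0 :
    (forall x y, (x \in row y) = (y \in col x)) -> y0 \notin col x0 ->
  (#|F| ^ 2 * \sum_(x : finvect_type G) #|F| ^ \dim (col x) + #|F| ^ (\dim {:G} + \dim {:H})
    <= 2 * #|F| * #|F| ^ (\dim {:G} + \dim {:H}))%N.
Proof.
move=> mem_row nfull; set q := #|F|; have q1 : (1 < q)%N := finNzRing_gt1 F.
have q0 : (0 < q)%N by rewrite ltnW.
have proper (V : vectType F) (W : {vspace V}) v : v \notin W ->
    (q * q ^ \dim W <= q ^ \dim {:V})%N.
  move=> nv; rewrite -expnS leq_pexp2l // ltn_neqAle dimvS ?subvf // andbT.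
  apply: contra nv => /eqP e; rewrite (_ : W = fullv) ?memvf //.
  by apply/eqP; rewrite eqEdim subvf e /=.
have -> : (\sum_(x : finvect_type G) q ^ \dim (col x) =
    \sum_(y : finvect_type H) q ^ \dim (row y))%N.
  have := sum_rows mem_row fullv fullv.
  by congr (_ = _); apply: eq_big => z; rewrite ?memvf // => _; rewrite capfv.
have le_sum : (q * \sum_(y : finvect_type H) q ^ \dim (row y) <=
    \sum_(y : finvect_type H) q ^ \dim {:G} +
    \sum_(y : finvect_type H | (y : H) \in col x0) q.-1 * q ^ \dim {:G})%N.
  rewrite [X in (_ <= _ + X)%N]big_mkcond -big_split big_distrr /=.
  apply: leq_sum => y _; case: ifP => [x0y|nx0y].
    rewrite -mulSn prednK // leq_mul2l (leq_pexp2l q0) ?orbT //.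
    by rewrite dimvS ?subvf.
  by rewrite addn0 (proper _ _ x0) // mem_row nx0y.
have cardV (V : vectType F) : #|finvect_type V| = (q ^ \dim {:V})%N.
  by rewrite -card_vset; apply: eq_card => v; rewrite !inE memvf.
rewrite !sum_nat_const cardV in le_sum.
have cardC : #|[pred y : finvect_type H | (y : H) \in col x0]| = (q ^ \dim (col x0))%N.
  by rewrite -card_vset cardsE.
rewrite {}cardC in le_sum; have {}proper := proper _ _ _ nfull.
rewrite expnD -mulnn -mulnA.
have := leq_mul (leqnn q) le_sum; move: proper.
move: (q ^ \dim (col x0))%N (q ^ \dim {:G})%N (q ^ \dim {:H})%N => c g h le_c.
have := leq_mul le_c (leqnn (q.-1 * g)); case: (q) q0 => // m _ /=.
nia.
Qed.

(** * From a transverse set to its families of subspaces *)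

Lemma card_sum_columns (I J : finType) (A : {set I * J}) :
  #|A| = (\sum_i #|[set j | (i, j) \in A]|)%N.
Proof.
rewrite -sum1_card (eq_bigl (fun ij => true && ((ij.1, ij.2) \in A))); last by case.
rewrite -(pair_big_dep xpredT (fun i j => (i, j) \in A) (fun _ _ => 1%N)) /=.
by apply: eq_bigr => i _; rewrite sum1_card cardsE.
Qed.

Lemma transverse_spaces (F : finFieldType) (G H : vectType F)
    (A : {set finvect_type G * finvect_type H}) :
  transverse A ->
  exists (col : G -> {vspace H}) (row : H -> {vspace G}),
  [/\ forall x y, (x \in row y) = (y \in col x),
      forall (x : finvect_type G) (y : finvect_type H), ((x, y) \in A) = ((y : H) \in col x) &
      #|A| = (\sum_(x : finvect_type G) #|F| ^ \dim (col x))%N].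
Proof.
case=> /fin_all_exists[col colP] /fin_all_exists[row rowP].
have memA (x : finvect_type G) (y : finvect_type H) : ((x, y) \in A) = ((y : H) \in col x).
  by have /setP/(_ y) := colP x; rewrite !inE.
exists col, row; split=> //.
  by move=> x y; rewrite -(memA x y); have /setP/(_ x) := rowP y; rewrite !inE.
by rewrite card_sum_columns; apply: eq_bigr => x _; rewrite -card_vset -(colP x).
Qed.

(** * Estimates for the logarithm *)

Section LogBounds.
Variable R : realType.
Implicit Type delta : R.

Lemma logb_inv_ge0 (p : nat) delta : (1 < p)%N -> 0 < delta -> delta <= 1 ->
  0 <= logb p delta^-1.
Proof.
move=> p1 d0 d1; apply: divr_ge0; last by rewrite ln_ge0 // ler1n ltnW.
by rewrite ln_ge0 // invf_ge1.
Qed.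

Lemma pow_mul_density_ge1 (p K : nat) delta : (1 < p)%N -> 0 < delta ->
  logb p delta^-1 < K%:R -> 1 <= p%:R ^+ K * delta.
Proof.
move=> p1 d0; have p0 : 0 < p%:R :> R by rewrite ltr0n ltnW.
rewrite ltr_pdivrMr ?ln_gt0 ?ltr1n // mulr_natl -lnXn // ltr_ln ?posrE ?invr_gt0 ?exprn_gt0 //.
by rewrite -(ltr_pM2r d0) mulVf ?gt_eqF // => /ltW.
Qed.

(** The claim amounts to [delta^3 * p <= 1], which follows from [(2p - 1)^3 <= p^5]: this is
    [27 <= 32] for [p = 2], and [8 <= p^2] suffices for [p >= 3]. *)
Lemma logb_inv_ge_third (p : nat) delta : (1 < p)%N -> 0 < delta ->
  delta * p%:R ^+ 2 <= 2 * p%:R - 1 -> 1 <= 3 * logb p delta^-1.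
Proof.
move=> p1 d0 small; have p0 : 0 < p%:R :> R by rewrite ltr0n ltnW.
have p2 : 2 <= p%:R :> R by rewrite ler_nat.
have cube : delta ^+ 3 * p%:R <= 1.
  rewrite -(ler_pM2r (exprn_gt0 5 p0)) mul1r -mulrA -exprS (exprM _ 2 3) -exprMn.
  apply: le_trans (_ : (2 * p%:R - 1) ^+ 3 <= _).
    by rewrite lerXn2r ?nnegrE ?mulr_ge0 ?exprn_ge0 ?(ltW p0) ?(ltW d0) //; lra.
  have -> : 2 * p%:R - 1 = (2 * p - 1)%:R :> R by rewrite natrB ?natrM //; lia.
  rewrite -!natrX ler_nat; case: (ltnP p 3) => [p3|p3].
    by have -> : p = 2%N by lia.
  apply: leq_trans (_ : (2 * p) ^ 3 <= _)%N; first by rewrite leq_exp2r // leq_subr.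
  have p9 : (9 <= p ^ 2)%N by rewrite -mulnn (leq_mul p3 p3).
  by rewrite expnMn (expnD p 2 3) leq_mul2r (leq_trans _ p9) ?orbT.
rewrite mulrA ler_pdivlMr ?ln_gt0 ?ltr1n // mul1r mulr_natl -lnXn ?invr_gt0 //.
rewrite ler_ln ?posrE ?exprn_gt0 ?invr_gt0 //.
by rewrite exprVn -(ler_pM2l (exprn_gt0 3 d0)) mulfV ?gt_eqF ?exprn_gt0.
Qed.

Lemma natrS_le_quadruple (n : nat) (k : R) :
  n%:R <= k -> 1 <= 3 * k -> n.+1%:R <= 4 * k.
Proof. by rewrite -natr1; lra. Qed.

Lemma natr_le_of_pow (n K c C j : nat) (k : R) :
  0 <= k -> K%:R <= 4 * k -> (n <= c * K ^ j)%N -> (c * 4 ^ j <= C)%N ->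
  n%:R <= C%:R * k ^+ j.
Proof.
move=> k0 leK le_n le_C; apply: le_trans (_ : (c * K ^ j)%:R <= _); first by rewrite ler_nat.
rewrite natrM natrX; apply: le_trans (_ : c%:R * (4 * k) ^+ j <= _).
  by rewrite ler_wpM2l ?ler0n // lerXn2r ?nnegrE ?ler0n ?mulr_ge0.
rewrite exprMn mulrA; apply: ler_wpM2r; first exact: exprn_ge0.
by rewrite -natrX -natrM ler_nat.
Qed.

End LogBounds.

Theorem theorem5 (R : realType) :
  exists C : R, 0 < C /\
    forall (p : nat) (p_prime : prime p) (G H : vectType 'F_p) (delta : R)
      (delta_gt0 : 0 < delta) (delta_le1 : delta <= 1)
      (A : {set finvect_type G * finvect_type H})
      (A_transverse : transverse A)
      (A_dense : delta * #|finvect_type G|%:R * #|finvect_type H|%:R <= #|A|%:R),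
    exists (U : {vspace G}) (V : {vspace H}) (r : nat)
      (beta : {bilinear G -> H -> 'rV['F_p]_r}),
      [/\ bilinear_variety U V beta \subset A,
          (codimv U)%:R <= C * `| logb p delta^-1 ^+ 3 |,
          (codimv V)%:R <= C * `| logb p delta^-1 ^+ 2 | &
          r%:R <= C * `| logb p delta^-1 |].
Proof.
(* Any constant at least [82 * 4 ^ 3 = 5248] works below; the 4 comes from [K <= 4 * k]. *)
exists 6000%:R; split=> [|p p_prime G H delta delta_gt0 delta_le1 A A_transverse A_dense].
  by rewrite ltr0n.
have p1 := prime_gt1 p_prime.
have k_ge0 := logb_inv_ge0 p1 delta_gt0 delta_le1.
set k := logb p delta^-1 in k_ge0 *.
rewrite !ger0_norm ?exprn_ge0 //.
have [col [row [mem_row memA cardA]]] := transverse_spaces A_transverse.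
(* A full [A] is treated apart: there [k] may be 0, which leaves no room for additive constants. *)
have [/eqP fullA|nfullA] := boolP (A == setT).
  have [||beta _] := @biadditive_Fp_bilinear p G H 'rV['F_p]_0 (fun _ _ => 0) p_prime.
  - by move=> y x x'; rewrite addr0.
  - by move=> x a y y'; rewrite scaler0 addr0.
  exists fullv, fullv, 0%N, beta; rewrite /codimv !subnn fullA subsetT.
  by split=> //; apply: mulr_ge0; rewrite ?exprn_ge0 ?ler0n.
have [x0 [y0 nA]] : exists x0 y0, y0 \notin col x0.
  have /subsetPn[[x0 y0] _ nA] : ~~ (setT \subset A).
    by apply: contra nfullA; rewrite subTset.
  by exists x0, y0; rewrite -(memA x0 y0).
have gap := nonfull_density_gap mem_row nA.
have cardV (V : vectType 'F_p) : #|finvect_type V| = (p ^ \dim {:V})%N.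
  have := card_vset (fullv : {vspace V}); rewrite card_Fp // => <-.
  by apply: eq_card => v; rewrite !inE memvf.
have N_gt0 : 0 < (p ^ (\dim {:G} + \dim {:H}))%:R :> R.
  by rewrite ltr0n expn_gt0 prime_gt0.
rewrite -cardA card_Fp // in gap.
rewrite -mulrA -natrM !cardV -expnD in A_dense.
(* Turns the bounds in terms of the integer [K > k] into bounds in terms of [k]. *)
have k_big : 1 <= 3 * k.
  apply: logb_inv_ge_third => //; rewrite -(ler_pM2r N_gt0) mulrAC.
  move: gap; rewrite -(ler_nat R) !(natrD, natrM) natrX => gap.
  rewrite mulrBl mul1r lerBrDr; apply: le_trans gap; rewrite lerD2r.
  by rewrite -expr2 mulrC; apply: ler_wpM2l; rewrite ?exprn_ge0 // -natrX.
pose K := (Num.truncn k).+1.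
have ltK : k < K%:R by exact: truncnS_gt.
have leK : K%:R <= 4 * k.
  by apply: natrS_le_quadruple => //; rewrite truncn_le.
have [|U [V [Y [P [[dimU dimV dimY] PY addP kerP]]]]] :=
    exists_biadditive_of_dense (K := K) mem_row.
  rewrite -cardA card_Fp // -(ler_nat R) natrM.
  have pK_ge0 : 0 <= (p ^ K)%:R :> R by rewrite ler0n.
  apply: le_trans (ler_wpM2l pK_ge0 A_dense).
  have pK_delta : 1 <= (p ^ K)%:R * delta by rewrite natrX pow_mul_density_ge1.
  by rewrite mulrA ler_peMl // ltW.
(* [P] is additive only over [U] and [V], so it is extended through the projections; coordinates in
   [Y] give [r = \dim Y]. *)
pose f x y := \row_i coord (vbasis Y) i (P (projv U x) (projv V y)).
have [||beta betaE] := @biadditive_Fp_bilinear p G H 'rV['F_p]_(\dim Y) f p_prime.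
- move=> y x x'; apply/rowP=> i; rewrite !mxE linearD /=.
  by rewrite addP ?memv_proj // linearD.
- by move=> x a y y'; apply/rowP=> i; rewrite !mxE !linearP.
exists U, V, (\dim Y), beta; split.
- apply/subsetP=> -[x y]; rewrite inE memA /= => /and3P[Ux Vy /eqP].
  rewrite betaE /f !projv_id // => f0; apply: kerP => //.
  rewrite (coord_vbasis (PY x y)) big1 // => i _.
  by have /rowP/(_ i) := f0; rewrite !mxE => ->; rewrite scale0r.
(* 82, 21 and 4 are the values at [K = 1] of the three bounds, polynomials in [K >= 1] with
   nonnegative coefficients. The one for [U] is in fact only quadratic. *)
- apply: natr_le_of_pow k_ge0 leK _ (_ : 82 * 4 ^ 3 <= 6000)%N => //.
  rewrite /codimv leq_subLR (leq_trans dimU) // leq_add2l /K.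
  by move: (Num.truncn k) => n; clear; nia.
- apply: natr_le_of_pow k_ge0 leK _ (_ : 21 * 4 ^ 2 <= 6000)%N => //.
  rewrite /codimv leq_subLR (leq_trans dimV) // leq_add2l /K.
  by move: (Num.truncn k) => n; clear; nia.
- rewrite -[k]expr1; apply: natr_le_of_pow k_ge0 leK _ (_ : 4 * 4 ^ 1 <= 6000)%N => //.
  by rewrite (leq_trans dimY) // /K; move: (Num.truncn k) => n; clear; lia.
Qed.
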